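(* Let $(Z,\partial Z)$ be an NDR pair of topological spaces. Then the canonical morphism of flows $\mathrm{Glob}(\partial Z)\to\mathrm{Glob}(Z)$ satisfies the S-homotopy extension property.
   Context: $\mathbf{Top}$ is the category of compactly generated spaces (weak Hausdorff $k$-spaces) and continuous maps; all spaces are in $\mathbf{Top}$, and products and limits are taken in $\mathbf{Top}$. NDR pair means neighborhood deformation retract pair in the usual sense. A flow $X$ consists of a space $\mathbb{P}X$ (path space), a discrete space $X^0$ ($0$-skeleton), continuous maps $s,t:\mathbb{P}X\to X^0$, and a continuous associative map $*:\{(x,y)\in \mathbb{P}X\times\mathbb{P}X;\ t(x)=s(y)\}\to\mathbb{P}X$ with $s(x*y)=s(x)$, $t(x*y)=t(y)$ (no identities are required). A morphism of flows $f:X\to Y$ is a set map $f^0:X^0\to Y^0$ together with a continuous map $\mathbb{P}f:\mathbb{P}X\to\mathbb{P}Y$ commuting with $s$, $t$ and $*$. It is synchronized if $f^0$ is a bijection. For a space $Z$, $\mathrm{Glob}(Z)$ is the flow with $\mathrm{Glob}(Z)^0=\{0,1\}$, $\mathbb{P}\,\mathrm{Glob}(Z)=Z$, $s=0$, $t=1$; $\mathrm{Glob}$ is a functor. For a space $U$ and a flow $Y$, $\{U,Y\}_S$ is the flow with $0$-skeleton $Y^0$ and, for $\alpha,\beta\in Y^0$, space of paths from $\alpha$ to $\beta$ equal to $\mathbf{TOP}(U,\mathbb{P}_{\alpha,\beta}Y)$ (internal hom of $\mathbf{Top}$; $\mathbb{P}_{\alpha,\beta}Y$ is the subspace of paths with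 $s=\alpha$, $t=\beta$), with pointwise composition. The functor $\{U,-\}_S$ has a left adjoint $U\boxtimes -$. It is functorial in $U$ and $\{*\}\boxtimes X\cong X$; for $u\in U$, $u\boxtimes x$ denotes the image of $x\in X$ under $X\cong\{u\}\boxtimes X\to U\boxtimes X$. A synchronized morphism $i:A\to X$ satisfies the S-homotopy extension property if for every flow $Y$, every morphism $f:X\to Y$ and every morphism $h:[0,1]\boxtimes A\to Y$ with $h(0\boxtimes a)=f(i(a))$ for all $a\in A$, there is a morphism $H:[0,1]\boxtimes X\to Y$ with $H(0\boxtimes x)=f(x)$ for all $x\in X$ and $H(t\boxtimes i(a))=h(t\boxtimes a)$ for all $(t,a)\in[0,1]\times A$. *)

(* Defs.v *)
From HB Require Import structures.
From mathcomp Require Import all_boot all_order all_algebra.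
From mathcomp Require Import generic_quotient.
From mathcomp Require Import all_classical all_reals topology normedtype.

Set Implicit Arguments.
Unset Strict Implicit.
Unset Printing Implicit Defensive.

Import Order.TTheory GRing.Theory Num.Theory.
Import numFieldNormedType.Exports.

Local Open Scope classical_set_scope.
Local Open Scope quotient_scope.
Local Open Scope ring_scope.

Definition compact_hausdorff (K : topologicalType) :=
  compact [set: K] /\ hausdorff_space K.

(* [probed P] is [T] with the final topology for the maps [K -> T] in the
   class [P], where [K] ranges over compact Hausdorff spaces. *)
Section probed.
Variables (T : choiceType) (P : forall K : topologicalType, (K -> T) -> Prop).

Definition probed : Type := let _ := P in T.
HB.instance Definition _ := Choice.on probed.

Definition probe_open : set_system probed :=
  [set A | forall (K : topologicalType) (v : K -> T),
     compact_hausdorff K -> P v -> open (v @^-1` A)].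

Let probe_openT : probe_open setT.
Proof. by move=> K v _ _; exact: openT. Qed.

Let probe_openI : setI_closed probe_open.
Proof. by move=> A B oA oB K v cK Pv; apply: openI; [exact: oA|exact: oB]. Qed.

Let probe_open_bigU (I : Type) (f : I -> set probed) :
  (forall i, probe_open (f i)) -> probe_open (\bigcup_i f i).
Proof.
move=> fo K v cK Pv; rewrite preimage_bigcup.
by apply: bigcup_open => i _; exact: fo.
Qed.

HB.instance Definition _ :=
  isOpenTopological.Build probed probe_openT probe_openI probe_open_bigU.

Lemma probed_openE : @open probed = probe_open.
Proof. by []. Qed.

Lemma probe_continuous (K : topologicalType) (v : K -> T) :
  compact_hausdorff K -> P v -> continuous (v : K -> probed).
Proof. by move=> cK Pv; apply/continuousP => A oA; exact: oA. Qed.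

Lemma probed_continuousP (S : topologicalType) (f : T -> S) :
  (forall (K : topologicalType) (v : K -> T),
     compact_hausdorff K -> P v -> continuous (f \o v)) ->
  continuous (f : probed -> S).
Proof.
move=> fP; apply/continuousP => A oA; rewrite probed_openE => K v cK Pv.
by have /continuousP/(_ _ oA) := fP _ _ cK Pv.
Qed.

End probed.

Definition kify (T : topologicalType) : Type :=
  probed (fun (K : topologicalType) (v : K -> T) => continuous v).
HB.instance Definition _ (T : topologicalType) := Topological.on (kify T).

Definition k_space (T : topologicalType) := forall A : set T,
  (forall (K : topologicalType) (v : K -> T),
     compact_hausdorff K -> continuous v -> open (v @^-1` A)) -> open A.

Definition weak_hausdorff (T : topologicalType) :=
  forall (K : topologicalType) (v : K -> T),
    compact_hausdorff K -> continuous v -> closed (range v).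

HB.mixin Record isCG T & Topological T := {
  cg_k_space : k_space T ;
  cg_weak_hausdorff : weak_hausdorff T }.

#[short(type="cgType")]
HB.structure Definition CG := { T of Topological T & isCG T }.

Section k_theory.
Implicit Types (T S : topologicalType).

Lemma probed_k_space (T : choiceType)
    (P : forall K : topologicalType, (K -> T) -> Prop) : k_space (probed P).
Proof.
move=> A oA; rewrite probed_openE => K v cK Pv.
by apply: oA => //; exact: probe_continuous.
Qed.

Lemma k_space_continuous T S (f : T -> S) : k_space T ->
  (forall (K : topologicalType) (v : K -> T),
     compact_hausdorff K -> continuous v -> continuous (f \o v)) ->
  continuous f.
Proof.
move=> kT fP; apply/continuousP => A oA; apply: kT => K v cK cv.
by have /continuousP/(_ _ oA) := fP _ _ cK cv.
Qed.

Lemma from_kify T : continuous (idfun : kify T -> T).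
Proof. by apply: probed_continuousP => K v _. Qed.

Lemma to_kify T S (f : S -> T) : k_space S -> continuous f ->
  continuous (f : S -> kify T).
Proof.
move=> kS cf; apply: k_space_continuous => // K v cK cv.
apply: probe_continuous => //.
by move=> x; apply: continuous_comp; [exact: cv|exact: cf].
Qed.

Lemma compact_hausdorff_k_space T : compact_hausdorff T -> k_space T.
Proof. by move=> cT A /(_ T idfun cT); apply => x. Qed.

Lemma range_compact T S (f : T -> S) :
  compact [set: T] -> continuous f -> compact (range f).
Proof.
move=> cT cf; apply: continuous_compact => //.
exact: continuous_subspaceT.
Qed.

Lemma hausdorff_weak_hausdorff T : hausdorff_space T -> weak_hausdorff T.
Proof.
by move=> hT K v [cK _] cv; apply: compact_closed => //; exact: range_compact.
Qed.

Lemma kclosed T (A : set T) : k_space T ->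
  (forall (K : topologicalType) (v : K -> T),
     compact_hausdorff K -> continuous v -> closed (v @^-1` A)) -> closed A.
Proof.
move=> kT cA; rewrite -openC; apply: kT => K v cK cv.
by rewrite preimage_setC openC; exact: cA.
Qed.

Lemma prod_compact_hausdorff (K L : topologicalType) :
  compact_hausdorff K -> compact_hausdorff L -> compact_hausdorff (K * L)%type.
Proof.
move=> [cK hK] [cL hL]; split.
  by rewrite -setXTT; exact: compact_setX.
move=> [a b] [a' b'] ab; congr pair.
- apply: hK => A B nA nB.
  have [||[x y] [/= Ax Bx]] := ab (A `*` setT) (B `*` setT).
  + by exists (A, setT) => //; split => //; exact: filterT.
  + by exists (B, setT) => //; split => //; exact: filterT.
  by exists x; split; [case: Ax|case: Bx].
- apply: hL => A B nA nB.
  have [||[x y] [/= Ax Bx]] := ab (setT `*` A) (setT `*` B).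
  + by exists (setT, A) => //; split => //; exact: filterT.
  + by exists (setT, B) => //; split => //; exact: filterT.
  by exists y; split; [case: Ax|case: Bx].
Qed.

Lemma set_type_compact_hausdorff T (A : set T) :
  hausdorff_space T -> compact A -> compact_hausdorff (set_type A).
Proof.
move=> hT cA; split; last first.
  move=> x y xy; apply: val_inj; apply: hT => B C nB nC.
  have [||z [Bz Cz]] := xy (set_val @^-1` B) (set_val @^-1` C).
  - exact: (@initial_continuous _ _ (@set_val _ A)).
  - exact: (@initial_continuous _ _ (@set_val _ A)).
  by exists (set_val z).
move=> F PF _; have FA : F (set_val @^-1` A).
  by apply: (@filterS _ F _ setT) => [y _|]; [exact: set_valP|exact: filterT].
have [x [Ax Fx]] : A `&` cluster (set_val @ F) !=set0 by exact: cA.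
exists (exist _ x (mem_set Ax)); split => // B C FB [_ [[D oD <-] Dx DC]].
have FB' : F (set_val @^-1` (set_val @` B)).
  by apply: (@filterS _ F _ B) => // z Bz; exists z.
have nD : nbhs x D by exact: open_nbhs_nbhs.
have [y [[z Bz <-] Dz]] := Fx (set_val @` B) D FB' nD.
by exists z; split => //; exact: DC.
Qed.

Lemma closed_compact_hausdorff (K : topologicalType) (A : set K) :
  compact_hausdorff K -> closed A -> compact_hausdorff (set_type A).
Proof.
move=> [cK hK] cA; apply: set_type_compact_hausdorff => //.
exact: (subclosed_compact cA cK).
Qed.

Lemma compact_hausdorff_nbhs (K : topologicalType) (x : K) (A : set K) :
  compact_hausdorff K -> nbhs x A ->
  exists N : set K, [/\ nbhs x N, closed N & N `<=` A].
Proof.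
move=> [cK hK] nA.
have [B nB BA] := @compact_regular K x setT hK cK filterT A nA.
exists (closure B); split => //; last exact: closed_closure.
by apply: filterS nB; exact: subset_closure.
Qed.

Lemma pair_continuous (K T S : topologicalType) (f : K -> T) (g : K -> S) :
  continuous f -> continuous g -> continuous (fun k => (f k, g k)).
Proof. by move=> cf cg x; apply: cvg_pair; [exact: cf|exact: cg]. Qed.

Lemma fst_continuous T S : continuous (@fst T S).
Proof. by move=> [x y]; exact: cvg_fst. Qed.

Lemma snd_continuous T S : continuous (@snd T S).
Proof. by move=> [x y]; exact: cvg_snd. Qed.

Lemma equalizer_closed T (K L : topologicalType) (a : K -> T) (b : L -> T) :
  weak_hausdorff T -> compact_hausdorff K -> compact_hausdorff L ->
  continuous a -> continuous b -> closed [set p : K * L | a p.1 = b p.2].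
Proof.
move=> wT cK cL ca cb; rewrite -openC openE => -[k l] /= abkl.
have c1 (t : L) : closed (a @^-1` [set b t]).
  apply: (preimage_closed (f := a)) => [x _|]; first exact: ca.
  have -> : [set b t] = range (fun _ : set_type [set t] => b t).
    apply/seteqP; split => [_ ->|_ [_ _ <-]//].
    by exists (exist _ t (mem_set (erefl t))).
  apply: wT; last exact: cst_continuous.
  apply: closed_compact_hausdorff => //.
  exact/accessible_closed_set1/hausdorff_accessible/cL.2.
have [N [nN cN Na]] : exists N : set K,
    [/\ nbhs k N, closed N & N `<=` ~` (a @^-1` [set b l])].
  apply: compact_hausdorff_nbhs => //; apply: open_nbhs_nbhs; split => //.
  by rewrite openC.
have caN : closed (a @` N).
  have -> : a @` N = range (a \o (@set_val _ N)).
    apply/seteqP; split => [_ [x Nx <-]|_ [x _ <-]].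
      by exists (exist _ x (mem_set Nx)).
    by exists (set_val x) => //; exact: set_valP.
  apply: wT; first exact: closed_compact_hausdorff.
  move=> x; apply: continuous_comp; last exact: ca.
  exact: initial_continuous.
exists (N, b @^-1` (~` (a @` N))) => /=.
  split => //=; apply: open_nbhs_nbhs; split.
    by apply: open_comp => [x _|]; [exact: cb|rewrite openC].
  by move=> [x Nx /= axl]; exact: (Na x Nx).
by move=> [x y] /= [Nx Ny] axy; apply: Ny; exists x.
Qed.

(* A k-space whose points are separated by maps to weak Hausdorff spaces is
   weak Hausdorff. *)
Lemma separated_weak_hausdorff T : k_space T ->
  (forall x y : T, x <> y -> exists (S : topologicalType) (f : T -> S),
     [/\ weak_hausdorff S, continuous f & f x <> f y]) ->
  weak_hausdorff T.
Proof.
move=> kT sep K v cK cv; apply: kclosed => // L w cL cw.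
pose E := [set p : K * L | v p.1 = w p.2].
have cE : closed E.
  rewrite -openC openE => -[k l] /= /sep[S [f [wS cf fkl]]].
  have := @equalizer_closed S K L (f \o v) (f \o w) wS cK cL.
  have ca : continuous (f \o v).
    by move=> x; apply: continuous_comp; [exact: cv|exact: cf].
  have cb : continuous (f \o w).
    by move=> x; apply: continuous_comp; [exact: cw|exact: cf].
  move=> /(_ ca cb).
  rewrite -openC openE => /(_ (k, l) fkl); apply: filterS => -[x y] /= fxy vw.
  by apply: fxy; rewrite vw.
have -> : w @^-1` range v = snd @` E.
  apply/seteqP; split => [l [k _ vw]|_ [[k l] vw <-]]; first by exists (k, l).
  by exists k.
apply: compact_closed; first exact: cL.2.
apply: continuous_compact; first exact/continuous_subspaceT/snd_continuous.
have [cKL _] := prod_compact_hausdorff cK cL.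
exact: (subclosed_compact cE cKL).
Qed.

End k_theory.

Section k_constructions.
Implicit Types (T S : topologicalType) (X Y Z U : cgType).

Lemma cg_continuous X S (f : X -> S) :
  (forall (K : topologicalType) (v : K -> X),
     compact_hausdorff K -> continuous v -> continuous (f \o v)) ->
  continuous f.
Proof. by apply: k_space_continuous; exact: cg_k_space. Qed.

Lemma initial_topology_continuous (T : choiceType) S S' (f : T -> S)
    (g : S' -> T) :
  continuous (f \o g) -> continuous (g : S' -> initial_topology f).
Proof.
move=> /continuousP cfg; apply/continuousP => _ [B oB <-].
by have := cfg _ oB.
Qed.

Lemma kify_weak_hausdorff T : weak_hausdorff T -> weak_hausdorff (kify T).
Proof.
move=> wT; apply: separated_weak_hausdorff; first exact: probed_k_space.
by move=> x y xy; exists T, idfun; split => //; exact: from_kify.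
Qed.

End k_constructions.

Definition kprod (X Y : topologicalType) : Type := kify (X * Y)%type.
HB.instance Definition _ (X Y : topologicalType) := Topological.on (kprod X Y).

Lemma kfst_continuous (X Y : topologicalType) :
  continuous (fst : kprod X Y -> X).
Proof.
move=> x; apply: (@continuous_comp (kprod X Y) (X * Y)%type X idfun fst).
  exact: from_kify.
exact: fst_continuous.
Qed.

Lemma ksnd_continuous (X Y : topologicalType) :
  continuous (snd : kprod X Y -> Y).
Proof.
move=> x; apply: (@continuous_comp (kprod X Y) (X * Y)%type Y idfun snd).
  exact: from_kify.
exact: snd_continuous.
Qed.

Lemma kpair_continuous (S X Y : topologicalType) (f : S -> X) (g : S -> Y) :
  k_space S -> continuous f -> continuous g ->
  continuous ((fun s => (f s, g s)) : S -> kprod X Y).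
Proof. by move=> kS cf cg; apply: to_kify => //; exact: pair_continuous. Qed.

Lemma kprod_weak_hausdorff (X Y : topologicalType) :
  weak_hausdorff X -> weak_hausdorff Y -> weak_hausdorff (kprod X Y).
Proof.
move=> wX wY; apply: separated_weak_hausdorff; first exact: probed_k_space.
move=> [x y] [x' y'] neq; have [xx'|xx'] := pselect (x = x').
  exists Y, snd; split => //; first exact: ksnd_continuous.
  by move=> /= yy'; apply: neq; rewrite xx' yy'.
by exists X, fst; split => //; exact: kfst_continuous.
Qed.

HB.instance Definition _ (X Y : cgType) := isCG.Build (kprod X Y)
  (probed_k_space (P := _))
  (kprod_weak_hausdorff (@cg_weak_hausdorff X) (@cg_weak_hausdorff Y)).

(* Limits of compactly generated spaces are retopologized by [kify]. On closed
   subsets this changes nothing, see [ksub_openE]. *)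
Definition ksub (X : topologicalType) (A : set X) : Type := kify (set_type A).
HB.instance Definition _ (X : topologicalType) (A : set X) :=
  Topological.on (ksub A).

Definition kval (X : topologicalType) (A : set X) (x : ksub A) : X := set_val x.

Definition kmk (X : topologicalType) (A : set X) (x : X) (Ax : A x) : ksub A :=
  exist _ x (mem_set Ax).

Section ksub_theory.
Variables (X : topologicalType) (A : set X).

Lemma kvalP (x : ksub A) : A (kval x).
Proof. exact: set_valP. Qed.

Lemma kval_inj : injective (@kval X A).
Proof. exact: val_inj. Qed.

Lemma kval_continuous : continuous (@kval X A).
Proof.
move=> x; apply: (@continuous_comp (ksub A) A X idfun set_val).
  exact: from_kify.
exact: initial_continuous.
Qed.

Lemma kmk_continuous (S : topologicalType) (f : S -> X)
    (fA : forall s, A (f s)) :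
  k_space S -> continuous f -> continuous (fun s => kmk (fA s)).
Proof.
move=> kS cf; apply: to_kify => //.
exact: (@initial_topology_continuous _ _ _ set_val).
Qed.

Lemma ksub_weak_hausdorff : weak_hausdorff X -> weak_hausdorff (ksub A).
Proof.
move=> wX; apply: separated_weak_hausdorff; first exact: probed_k_space.
move=> x y xy; exists X, (@kval X A); split => //; first exact: kval_continuous.
by move=> /kval_inj.
Qed.

Lemma ksub_openE (B : set (ksub A)) : k_space X -> closed A ->
  open B <-> open (B : set (set_type A)).
Proof.
move=> kX cA; split; last first.
  by move=> oB; rewrite probed_openE => K v _ /continuousP; apply.
move=> oB; pose C : set X := (@kval X A) @` (~` B).
have cC : closed C.
  apply: kclosed => // K v cK cv.
  have cvA : closed (v @^-1` A).
    by apply: preimage_closed => // x _; exact: cv.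
  have cH := closed_compact_hausdorff cK cvA.
  pose w (k : set_type (v @^-1` A)) : ksub A :=
    @kmk X A (v (set_val k)) (set_valP k).
  have cw : continuous w.
    apply: kmk_continuous; first exact: compact_hausdorff_k_space.
    move=> k; apply: continuous_comp; last exact: cv.
    exact: initial_continuous.
  have -> : v @^-1` C = set_val @` (w @^-1` (~` B)).
    apply/seteqP; split => [k [x nBx xk]|_ [k nBk <-]]; last first.
      by exists (w k).
    have Avk : A (v k) by rewrite -xk; exact: kvalP.
    exists (exist _ k (mem_set Avk)) => //=.
    by rewrite (_ : w _ = x)//; apply: kval_inj; rewrite xk.
  apply: compact_closed; first exact: cK.2.
  apply: continuous_compact.
    exact/continuous_subspaceT/initial_continuous.
  apply: (subclosed_compact _ cH.1) => //.
  by apply: preimage_closed => [k _|]; [exact: cw|rewrite closedC].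
exists (~` C); first by rewrite openC.
apply/seteqP; split => x /=.
  by move=> nCx; apply: contrapT => nBx; apply: nCx; exists x.
by move=> Bx [y nBy yx]; apply: nBy; rewrite (kval_inj yx).
Qed.

End ksub_theory.

HB.instance Definition _ (X : cgType) (A : set X) := isCG.Build (ksub A)
  (probed_k_space (P := _))
  (ksub_weak_hausdorff (A := A) (@cg_weak_hausdorff X)).

(* The compact-open topology uses all compact subsets of [U]; restricting to
   the images of compact Hausdorff spaces gives the same topology after
   [kify]. *)
Definition map_space (U Y : topologicalType) : Type := initial_topology
  ((fun f => f) : continuousType U Y -> {compact-open, U -> Y}).
HB.instance Definition _ (U Y : topologicalType) :=
  Topological.on (map_space U Y).

Definition ktop (U Y : topologicalType) : Type := kify (map_space U Y).
HB.instance Definition _ (U Y : topologicalType) := Topological.on (ktop U Y).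

Definition kapp (U Y : topologicalType) (f : ktop U Y) : U -> Y :=
  (f : continuousType U Y).

Definition kmap (U Y : topologicalType) (f : U -> Y) (cf : continuous f) :
  ktop U Y := (mkcts cf : continuousType U Y).

Section ktop_theory.
Variables (U Y : topologicalType).

Lemma kapp_cont (f : ktop U Y) : continuous (kapp f).
Proof. exact: (@cts_fun U Y (f : continuousType U Y)). Qed.

Lemma ktop_ext (f g : ktop U Y) : kapp f =1 kapp g -> f = g.
Proof. by move=> fg; apply/continuousEP. Qed.

Lemma kapp_continuous (K : topologicalType) (m : K -> ktop U Y) (b : K -> U) :
  compact_hausdorff K -> continuous m -> continuous b ->
  continuous (fun k => kapp (m k) (b k)).
Proof.
move=> cK cm cb; apply/continuousP => O oO; rewrite openE => k0 /= Ok0.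
have [N [nN cN NO]] : exists N : set K,
    [/\ nbhs k0 N, closed N & N `<=` (kapp (m k0) \o b) @^-1` O].
  apply: compact_hausdorff_nbhs => //; apply: open_nbhs_nbhs; split => //.
  apply: open_comp => // k _; apply: continuous_comp; first exact: cb.
  exact: kapp_cont.
have cbN : compact (b @` N).
  apply: continuous_compact; first exact: continuous_subspaceT.
  by apply: (subclosed_compact cN cK.1).
have oW := compact_open_open cbN oO.
have cm' : continuous (m : K -> {compact-open, U -> Y}).
  move=> k; apply: (@continuous_comp K (map_space U Y)); last first.
    exact: initial_continuous.
  apply: (@continuous_comp K (ktop U Y) (map_space U Y) m idfun).
    exact: cm.
  exact: from_kify.
have : nbhs k0 ((m : K -> {compact-open, U -> Y}) @^-1`
    [set g | g @` (b @` N) `<=` O]).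
  apply: open_nbhs_nbhs; split; first by apply: open_comp => // k _; exact: cm'.
  by move=> _ [_ [k Nk <-] <-]; exact: NO.
move=> nW; apply: filterS (filterI nN nW) => k [Nk]; apply.
by exists (b k) => //; exists k.
Qed.

Lemma ktop_continuous (X : topologicalType) (F : X -> ktop U Y) :
  k_space X -> k_space U ->
  (forall (K : topologicalType) (a : K -> X) (b : K -> U),
     compact_hausdorff K -> continuous a -> continuous b ->
     continuous (fun k => kapp (F (a k)) (b k))) ->
  continuous F.
Proof.
move=> kX kU cF; apply: k_space_continuous => // K a cK ca.
apply: to_kify; first exact: compact_hausdorff_k_space.
apply: initial_topology_continuous => k0.
apply/compact_open_cvgP => C O cC oO CO /=.
pose G k u := kapp (F (a k)) u.
have cG (L : topologicalType) (b : L -> U) : compact_hausdorff L ->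
    continuous b -> continuous (fun p : K * L => G p.1 (b p.2)).
  move=> cL cb; apply: (cF _ (a \o fst) (b \o snd)).
  - exact: prod_compact_hausdorff.
  - move=> p; apply: continuous_comp; last exact: ca.
    exact: fst_continuous.
  - move=> p; apply: continuous_comp; last exact: cb.
    exact: snd_continuous.
suff H : forall u, C u ->
    \forall u' \near u & k \near k0, O (G k u').
  have nC := (compact_near_coveringP C).1 cC K (nbhs k0) (fun k u => O (G k u))
    (nbhs_filter k0) H.
  change (nbhs k0 [set k | kapp (F (a k)) @` C `<=` O]).
  by apply: filterS nC => k Ck _ [u Cu <-]; exact: Ck.
move=> u Cu; have Ou : O (G k0 u) by apply: CO; exists u.
have [N [nN cN NO]] : exists N : set K,
    [/\ nbhs k0 N, closed N & N `<=` (G ^~ u) @^-1` O].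
  apply: compact_hausdorff_nbhs => //; apply: open_nbhs_nbhs; split => //.
  apply: open_comp => // k _; apply: (cF K a (cst u)) => //.
  exact: cst_continuous.
have cptN : compact N by apply: (subclosed_compact cN cK.1).
pose M := [set u' | forall k, N k -> O (G k u')].
have oM : open M.
  apply: kU => L b cL cb; rewrite openE => l Ml.
  apply: ((compact_near_coveringP N).1 cptN L (nbhs l)
    (fun l k => O (G k (b l))) (nbhs_filter l) _) => k Nk.
  have := cG L b cL cb (k, l) O; apply.
  by apply: open_nbhs_nbhs; split => //; exact: Ml.
exists (M, N) => /=; last by move=> [u' k] /= [Mu' Nk]; exact: Mu'.
by split => //; apply: open_nbhs_nbhs; split => // k /NO.
Qed.

Lemma ktop_weak_hausdorff : weak_hausdorff Y -> weak_hausdorff (ktop U Y).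
Proof.
move=> wY; apply: separated_weak_hausdorff; first exact: probed_k_space.
move=> f g fg; have [u fgu] : exists u, kapp f u <> kapp g u.
  by apply: contrapT => /forallNP H; apply: fg; apply: ktop_ext => u;
    exact: contrapT (H u).
exists Y, (fun h => kapp h u); split => //.
apply: k_space_continuous; first exact: probed_k_space.
move=> K v cK cv; apply: (kapp_continuous (b := cst u)) => //.
exact: cst_continuous.
Qed.

End ktop_theory.

HB.instance Definition _ (U : topologicalType) (Y : cgType) :=
  isCG.Build (ktop U Y)
    (probed_k_space (P := _)) (ktop_weak_hausdorff (@cg_weak_hausdorff Y)).

Section sum.
Variables (I : choiceType) (X : I -> cgType).

Lemma sum_k_space : k_space {i & X i}.
Proof.
move=> A oA; apply/sigT_openP => i; apply: cg_k_space => K v cK cv.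
apply: (oA K (existT _ i \o v)) => // k.
by apply: continuous_comp; [exact: cv|exact: existT_continuous].
Qed.

Lemma sum_weak_hausdorff : weak_hausdorff {i & X i}.
Proof.
apply: separated_weak_hausdorff; first exact: sum_k_space.
move=> [i x] [j y]; have [ij|ij] := eqVneq i j; last first.
  move=> _; exists bool, (fun z => projT1 z == i); split => /=.
  - exact/hausdorff_weak_hausdorff/discrete_hausdorff.
  - apply/continuousP => A _; apply/sigT_openP => k.
    have [kA|kA] := pselect (A (k == i)).
      by rewrite (_ : _ @^-1` _ = setT); [exact: openT|apply/seteqP; split].
    by rewrite (_ : _ @^-1` _ = set0); [exact: open0|apply/seteqP; split].
  - by rewrite eqxx eq_sym (negbTE ij).
subst j => xy; pose f (z : {i & X i}) : X i :=
  if @eqP _ (projT1 z) i is ReflectT e then ecast l (X l) e (projT2 z) else x.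
have fE (z : X i) : f (existT _ i z) = z.
  by rewrite /f/=; case: eqP => // e; rewrite eq_axiomK.
exists (X i), f; split; first exact: cg_weak_hausdorff.
- apply/continuousP => A oA; apply/sigT_openP => k; rewrite -comp_preimage.
  suff /continuousP/(_ _ oA) : continuous (f \o existT _ k) by [].
  rewrite /f /comp/=; case: eqP => [e|_]; last exact: cst_continuous.
  by case: _ / e => z.
- by rewrite !fE => exy; apply: xy; rewrite exy.
Qed.

End sum.

HB.instance Definition _ (I : choiceType) (X : I -> cgType) :=
  isCG.Build {i & X i} (@sum_k_space I X) (@sum_weak_hausdorff I X).

Section unit_interval.
Variable R : realType.

Definition unit_interval : Type := `[0 : R, 1]%classic.
HB.instance Definition _ := Topological.on unit_interval.

Lemma unit_interval_compact_hausdorff : compact_hausdorff unit_interval.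
Proof.
apply: set_type_compact_hausdorff; last exact: segment_compact.
exact: Rhausdorff.
Qed.

HB.instance Definition _ := isCG.Build unit_interval
  (compact_hausdorff_k_space unit_interval_compact_hausdorff)
  (hausdorff_weak_hausdorff unit_interval_compact_hausdorff.2).

Let zero_in : `[0 : R, 1]%classic 0.
Proof. by rewrite /= in_itv/= lexx ler01. Qed.

Let one_in : `[0 : R, 1]%classic 1.
Proof. by rewrite /= in_itv/= lexx ler01. Qed.

Definition I0 : unit_interval := exist _ 0 (mem_set zero_in).
Definition I1 : unit_interval := exist _ 1 (mem_set one_in).
End unit_interval.

Section more_continuity.

Lemma comp_cont (R S T : topologicalType) (f : R -> S) (g : S -> T) :
  continuous f -> continuous g -> continuous (fun x => g (f x)).
Proof. by move=> cf cg x; apply: continuous_comp; [exact: cf|exact: cg]. Qed.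

Lemma ksub_continuous (S X : topologicalType) (A : set X) (f : S -> ksub A) :
  k_space S -> continuous (fun s => kval (f s)) -> continuous f.
Proof.
move=> kS cf; apply: to_kify => //.
exact: (@initial_topology_continuous _ _ _ set_val).
Qed.

Lemma local_continuous (K S : topologicalType) (f : K -> S) :
  (forall k0, exists D : set K,
     [/\ open D, D k0 & continuous (fun d : set_type D => f (set_val d))]) ->
  continuous f.
Proof.
move=> fP; apply/continuousP => O oO; rewrite openE => k0 /= Ok0.
have [D [oD Dk0 /continuousP/(_ _ oO)[W oW WE]]] := fP k0.
have : nbhs k0 (W `&` D).
  apply: open_nbhs_nbhs; split; first exact: openI.
  split => //.
  have : (set_val @^-1` W) (exist _ k0 (mem_set Dk0) : set_type D) by rewrite WE.
  by [].
apply: filterS => k [Wk Dk].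
have : (set_val @^-1` W) (exist _ k (mem_set Dk) : set_type D) by [].
by rewrite WE.
Qed.

Lemma discrete_clopen (K : topologicalType) (D : discreteTopologicalType)
    (f : K -> D) (d : D) : continuous f -> clopen (f @^-1` [set d]).
Proof.
move=> cf; apply: preimage_clopen; last by move=> x; exact: cf.
by split; [exact: discrete_open|exact: discrete_closed].
Qed.

End more_continuity.

(* The fibre product of [t] and [s] in compactly generated spaces. *)
Definition composable (P : topologicalType) (S : Type) (s t : P -> S) : Type :=
  ksub [set p : kprod P P | t p.1 = s p.2].
HB.instance Definition _ (P : cgType) (S : Type) (s t : P -> S) :=
  CG.on (composable s t).

Record flow := Flow {
  skel : discreteTopologicalType ;
  paths : cgType ;
  src : paths -> skel ;
  tgt : paths -> skel ;
  src_continuous : continuous src ;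
  tgt_continuous : continuous tgt ;
  pcomp : forall x y : paths, tgt x = src y -> paths ;
  pcomp_continuous :
    continuous (fun p : composable src tgt => pcomp (kvalP p)) ;
  src_pcomp : forall (x y : paths) (e : tgt x = src y), src (pcomp e) = src x ;
  tgt_pcomp : forall (x y : paths) (e : tgt x = src y), tgt (pcomp e) = tgt y ;
  pcompA : forall (x y z : paths) (xy : tgt x = src y) (yz : tgt y = src z)
    (xy_z : tgt (pcomp xy) = src z) (x_yz : tgt x = src (pcomp yz)),
    pcomp xy_z = pcomp x_yz }.

Record flow_mor (X Y : flow) := FlowMor {
  mor0 : skel X -> skel Y ;
  morP : paths X -> paths Y ;
  morP_continuous : continuous morP ;
  mor_src : forall x, src (morP x) = mor0 (src x) ;
  mor_tgt : forall x, tgt (morP x) = mor0 (tgt x) ;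
  mor_pcomp : forall (x y : paths X) (e : tgt x = src y)
    (e' : tgt (morP x) = src (morP y)), morP (pcomp e) = pcomp e' }.

Lemma flow_mor_ext (X Y : flow) (f g : flow_mor X Y) :
  mor0 f =1 mor0 g -> morP f =1 morP g -> f = g.
Proof.
case: f g => [f0 f cf sf tf pf] [g0 g cg sg tg pg] /= /funext e0 /funext e1.
subst g0 g; congr FlowMor; exact: Prop_irrelevance.
Qed.

Definition synchronized (X Y : flow) (f : flow_mor X Y) := bijective (mor0 f).

Section composition.
Variables X Y Z : flow.

Lemma pcomp_eq (x x' y y' : paths X) (e : tgt x = src y) (e' : tgt x' = src y') :
  x = x' -> y = y' -> pcomp e = pcomp e'.
Proof. by move=> xx yy; subst x' y'; rewrite (Prop_irrelevance e e'). Qed.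

Lemma pcomp_pair_continuous (S : topologicalType) (f g : S -> paths X)
    (e : forall s, tgt (f s) = src (g s)) :
  k_space S -> continuous f -> continuous g -> continuous (fun s => pcomp (e s)).
Proof.
move=> kS cf cg.
pose h s : composable (@src X) (@tgt X) :=
  @kmk (kprod (paths X) (paths X)) [set p | tgt p.1 = src p.2] (f s, g s) (e s).
have ch : continuous h.
  by apply: ksub_continuous => //; exact: kpair_continuous.
rewrite (_ : (fun s => _) = (fun p => pcomp (kvalP p)) \o h); last first.
  by apply/funext => s; exact: pcomp_eq.
by move=> s; apply: continuous_comp; [exact: ch|exact: pcomp_continuous].
Qed.

Variables (g : flow_mor Y Z) (f : flow_mor X Y).

Let comp_continuous : continuous (morP g \o morP f).
Proof. by move=> x; apply: continuous_comp; exact: morP_continuous. Qed.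

Let comp_src x : src (morP g (morP f x)) = mor0 g (mor0 f (src x)).
Proof. by rewrite !mor_src. Qed.

Let comp_tgt x : tgt (morP g (morP f x)) = mor0 g (mor0 f (tgt x)).
Proof. by rewrite !mor_tgt. Qed.

Let comp_pcomp (x y : paths X) (e : tgt x = src y)
    (e' : tgt (morP g (morP f x)) = src (morP g (morP f y))) :
  morP g (morP f (pcomp e)) = pcomp e'.
Proof.
have e1 : tgt (morP f x) = src (morP f y) by rewrite mor_tgt mor_src e.
by rewrite (mor_pcomp e e1); exact: mor_pcomp.
Qed.

Definition mor_comp : flow_mor X Z :=
  @FlowMor X Z (mor0 g \o mor0 f) (morP g \o morP f)
    comp_continuous comp_src comp_tgt comp_pcomp.

End composition.

Definition paths_between (Y : flow) (a b : skel Y) : Type :=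
  ksub [set x : paths Y | src x = a /\ tgt x = b].
HB.instance Definition _ (Y : flow) (a b : skel Y) :=
  CG.on (paths_between a b).

(* [fhom U Y] is the flow [{U, Y}_S]. *)
Section fhom.
Variables (U : cgType) (Y : flow).

Definition fhom_between (ab : skel Y * skel Y) : cgType :=
  ktop U (paths_between ab.1 ab.2).

Definition fhom_paths : Type := {ab : skel Y * skel Y & fhom_between ab}.
HB.instance Definition _ := CG.on fhom_paths.

Definition fhom_src (w : fhom_paths) : skel Y := (projT1 w).1.
Definition fhom_tgt (w : fhom_paths) : skel Y := (projT1 w).2.

Definition fhom_app (w : fhom_paths) (u : U) : paths Y :=
  kval (kapp (projT2 w) u).

Lemma src_fhom_app w u : src (fhom_app w u) = fhom_src w.
Proof. by case: (kvalP (kapp (projT2 w) u)). Qed.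

Lemma tgt_fhom_app w u : tgt (fhom_app w u) = fhom_tgt w.
Proof. by case: (kvalP (kapp (projT2 w) u)). Qed.

Lemma fhom_app_cont w : continuous (fhom_app w).
Proof.
move=> u; apply: (@continuous_comp _ _ _ (kapp (projT2 w)) (@kval _ _)).
  exact: kapp_cont.
exact: kval_continuous.
Qed.

Lemma fhom_ext w w' : fhom_src w = fhom_src w' -> fhom_tgt w = fhom_tgt w' ->
  fhom_app w =1 fhom_app w' -> w = w'.
Proof.
case: w w' => [[a b] f] [[a' b'] f']; rewrite /fhom_src /fhom_tgt /=.
move=> ? ?; subst a' b' => ff; congr existT; apply: ktop_ext => u.
by apply: kval_inj; exact: ff.
Qed.

Section make.
Variables (a b : skel Y) (f : U -> paths Y) (cf : continuous f).
Hypothesis fab : forall u, src (f u) = a /\ tgt (f u) = b.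

Let f' (u : U) : paths_between a b :=
  @kmk _ [set x : paths Y | src x = a /\ tgt x = b] (f u) (fab u).

Let cf' : continuous f'.
Proof. by apply: ksub_continuous => //; exact: cg_k_space. Qed.

Definition fhom_mk : fhom_paths :=
  existT fhom_between (a, b) (kmap cf' : fhom_between (a, b)).

Lemma fhom_mkE u : fhom_app fhom_mk u = f u.
Proof. by []. Qed.

End make.

Lemma fhom_tag_continuous (S : topologicalType)
    (f : skel Y * skel Y -> S) : continuous (fun w : fhom_paths => f (projT1 w)).
Proof.
apply/continuousP => A _; apply/sigT_openP => i.
have [Afi|Afi] := pselect (A (f i)).
  by rewrite (_ : _ @^-1` _ = setT); [exact: openT|apply/seteqP; split].
by rewrite (_ : _ @^-1` _ = set0); [exact: open0|apply/seteqP; split].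
Qed.

Lemma fhom_src_continuous : continuous fhom_src.
Proof. exact: (@fhom_tag_continuous _ fst). Qed.

Lemma fhom_tgt_continuous : continuous fhom_tgt.
Proof. exact: (@fhom_tag_continuous _ snd). Qed.

Let recast (w : fhom_paths) (i : skel Y * skel Y) (e : projT1 w = i) :
  fhom_between i := ecast j (fhom_between j) e (projT2 w).

Let recastE w i (e : projT1 w = i) u :
  kval (kapp (recast e) u) = fhom_app w u.
Proof. by case: _ / e. Qed.

Let existT_recast w i (e : projT1 w = i) : existT fhom_between i (recast e) = w.
Proof. by case: w e => j f /= e; case: _ / e. Qed.

Let tag_clopen (K : topologicalType) (m : K -> fhom_paths) i :
  continuous (fhom_src \o m) -> continuous (fhom_tgt \o m) ->
  clopen [set k | projT1 (m k) = i].
Proof.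
move=> cs ct; rewrite (_ : [set k | _] =
  (fhom_src \o m) @^-1` [set i.1] `&` (fhom_tgt \o m) @^-1` [set i.2]).
  by apply: clopenI; exact: discrete_clopen.
apply/seteqP; split => [k /= <-//|k /=]; rewrite /fhom_src /fhom_tgt.
by case: (projT1 (m k)) i => ? ? [? ?] /= [-> ->].
Qed.

Lemma fhom_continuous (X : topologicalType) (m : X -> fhom_paths) :
  k_space X -> continuous (fhom_src \o m) -> continuous (fhom_tgt \o m) ->
  (forall (K : topologicalType) (a : K -> X) (b : K -> U),
     compact_hausdorff K -> continuous a -> continuous b ->
     continuous (fun k => fhom_app (m (a k)) (b k))) ->
  continuous m.
Proof.
move=> kX cs ct cm; apply: k_space_continuous => // K a cK ca.
apply: local_continuous => k0; pose i := projT1 (m (a k0)).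
have [oD cD] : clopen [set k | projT1 (m (a k)) = i].
  apply: (@tag_clopen K (m \o a)).
    exact: (comp_cont ca cs).
  exact: (comp_cont ca ct).
exists [set k | projT1 (m (a k)) = i]; split => //.
pose g (d : set_type [set k | projT1 (m (a k)) = i]) : fhom_between i :=
  recast (set_valP d).
have cg : continuous g.
  apply: ktop_continuous.
  - by apply: compact_hausdorff_k_space; exact: closed_compact_hausdorff.
  - exact: cg_k_space.
  move=> L a' b cL ca' cb.
  apply: ksub_continuous; first exact: compact_hausdorff_k_space.
  rewrite (_ : (fun s => _) = fun l => fhom_app (m (a (set_val (a' l)))) (b l)).
    apply: (cm L (a \o set_val \o a')) => // l.
    apply: continuous_comp; first exact: ca'.
    apply: continuous_comp; last exact: ca.
    exact: initial_continuous.
  by apply/funext => l; exact: recastE.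
rewrite (_ : (fun d => _) = existT fhom_between i \o g).
  by move=> d; apply: continuous_comp; [exact: cg|exact: existT_continuous].
by apply/funext => d /=; rewrite existT_recast.
Qed.

Lemma fhom_app_continuous (K : topologicalType) (m : K -> fhom_paths)
    (b : K -> U) :
  compact_hausdorff K -> continuous m -> continuous b ->
  continuous (fun k => fhom_app (m k) (b k)).
Proof.
move=> cK cm cb; apply: local_continuous => k0; pose i := projT1 (m k0).
have [oD cD] : clopen [set k | projT1 (m k) = i].
  apply: tag_clopen.
    exact: (comp_cont cm fhom_src_continuous).
  exact: (comp_cont cm fhom_tgt_continuous).
exists [set k | projT1 (m k) = i]; split => //.
pose g (d : set_type [set k | projT1 (m k) = i]) : fhom_between i :=
  recast (set_valP d).
have gE d : existT fhom_between i (g d) = m (set_val d).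
  exact: existT_recast.
have cg : continuous g.
  apply/continuousP => B oB.
  have oB' := @existT_open_map _
    (fun j => fhom_between j : topologicalType) i B oB.
  have cmv : continuous
      (fun d : set_type [set k | projT1 (m k) = i] => m (set_val d)).
    by apply: comp_cont cm; exact: initial_continuous.
  move/continuousP: cmv => /(_ _ oB').
  rewrite (_ : _ @^-1` _ = g @^-1` B)//.
  apply/seteqP; split => d /= => [[z Bz]|Bg]; last by exists (g d).
  by rewrite -gE => zE; have <- : z = g d by exact: eq_from_Tagged zE.
rewrite (_ : (fun d => _) = fun d => kval (kapp (g d) (b (set_val d)))).
  apply: comp_cont (@kval_continuous _ _).
  apply: kapp_continuous => //; first exact: closed_compact_hausdorff.
  by apply: comp_cont cb; exact: initial_continuous.
by apply/funext => d; rewrite recastE.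
Qed.

Section fhom_pcomp.
Variables (w w' : fhom_paths) (e : fhom_tgt w = fhom_src w').

Let app_e u : tgt (fhom_app w u) = src (fhom_app w' u).
Proof. by rewrite tgt_fhom_app src_fhom_app. Qed.

Let app_continuous : continuous (fun u => pcomp (app_e u)).
Proof.
by apply: pcomp_pair_continuous; [exact: cg_k_space|exact: fhom_app_cont..].
Qed.

Let app_between u : src (pcomp (app_e u)) = fhom_src w /\
  tgt (pcomp (app_e u)) = fhom_tgt w'.
Proof. by rewrite src_pcomp tgt_pcomp src_fhom_app tgt_fhom_app. Qed.

Definition fhom_pcomp : fhom_paths := fhom_mk app_continuous app_between.

Lemma fhom_pcompE u (e' : tgt (fhom_app w u) = src (fhom_app w' u)) :
  fhom_app fhom_pcomp u = pcomp e'.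
Proof. by rewrite fhom_mkE; exact: pcomp_eq. Qed.

End fhom_pcomp.

Lemma fhom_pcomp_continuous : continuous
  (fun p : composable fhom_src fhom_tgt => fhom_pcomp (kvalP p)).
Proof.
apply: fhom_continuous; first exact: cg_k_space.
- change (continuous (fun p : composable fhom_src fhom_tgt =>
    fhom_src (kval p).1)).
  apply: (comp_cont _ fhom_src_continuous).
  exact: (comp_cont (@kval_continuous _ _) (@kfst_continuous _ _)).
- change (continuous (fun p : composable fhom_src fhom_tgt =>
    fhom_tgt (kval p).2)).
  apply: (comp_cont _ fhom_tgt_continuous).
  exact: (comp_cont (@kval_continuous _ _) (@ksnd_continuous _ _)).
move=> K a b cK ca cb; apply: pcomp_pair_continuous.
- exact: compact_hausdorff_k_space.
- apply: fhom_app_continuous => //.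
  exact: (comp_cont (comp_cont ca (@kval_continuous _ _)) (@kfst_continuous _ _)).
- apply: fhom_app_continuous => //.
  exact: (comp_cont (comp_cont ca (@kval_continuous _ _)) (@ksnd_continuous _ _)).
Qed.

Let src_fhom_pcomp w w' (e : fhom_tgt w = fhom_src w') :
  fhom_src (fhom_pcomp e) = fhom_src w.
Proof. by []. Qed.

Let tgt_fhom_pcomp w w' (e : fhom_tgt w = fhom_src w') :
  fhom_tgt (fhom_pcomp e) = fhom_tgt w'.
Proof. by []. Qed.

Let fhom_pcompA x y z (xy : fhom_tgt x = fhom_src y)
    (yz : fhom_tgt y = fhom_src z) (xy_z : fhom_tgt (fhom_pcomp xy) = fhom_src z)
    (x_yz : fhom_tgt x = fhom_src (fhom_pcomp yz)) :
  fhom_pcomp xy_z = fhom_pcomp x_yz.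
Proof.
by apply: fhom_ext => // u; rewrite /fhom_pcomp !fhom_mkE; exact: pcompA.
Qed.

Definition fhom : flow := Flow fhom_src_continuous fhom_tgt_continuous
  fhom_pcomp_continuous src_fhom_pcomp tgt_fhom_pcomp fhom_pcompA.

End fhom.

Section fhom_functor.

Section map.
Variables (U : cgType) (Y Z : flow) (f : flow_mor Y Z).

Let app_continuous (w : paths (fhom U Y)) :
  continuous (fun u => morP f (fhom_app w u)).
Proof. exact: comp_cont (@fhom_app_cont _ _ w) (@morP_continuous _ _ f). Qed.

Let app_between (w : paths (fhom U Y)) (u : U) :
  src (morP f (fhom_app w u)) = mor0 f (src w) /\
  tgt (morP f (fhom_app w u)) = mor0 f (tgt w).
Proof. by rewrite mor_src mor_tgt src_fhom_app tgt_fhom_app. Qed.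

Let post (w : paths (fhom U Y)) : paths (fhom U Z) :=
  fhom_mk (@app_continuous w) (app_between w).

Let post_src w : src (post w) = mor0 f (src w).
Proof. by []. Qed.

Let post_tgt w : tgt (post w) = mor0 f (tgt w).
Proof. by []. Qed.

Let post_continuous : continuous post.
Proof.
apply: fhom_continuous; first exact: cg_k_space.
- change (continuous (fun w : paths (fhom U Y) => mor0 f (fhom_src w))).
  exact: (@fhom_tag_continuous U Y _ (fun ab => mor0 f ab.1)).
- change (continuous (fun w : paths (fhom U Y) => mor0 f (fhom_tgt w))).
  exact: (@fhom_tag_continuous U Y _ (fun ab => mor0 f ab.2)).
move=> K a b cK ca cb.
apply: comp_cont (@morP_continuous _ _ f).
exact: fhom_app_continuous.
Qed.

Let post_pcomp (x y : paths (fhom U Y)) (e : tgt x = src y)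
  (e' : tgt (post x) = src (post y)) : post (pcomp e) = pcomp e'.
Proof.
apply: fhom_ext => // u; rewrite /post !fhom_mkE.
by rewrite -(mor_pcomp (f := f)) ?tgt_fhom_app ?src_fhom_app// => e1;
  congr morP; exact: fhom_pcompE.
Qed.

Definition fhom_map : flow_mor (fhom U Y) (fhom U Z) :=
  @FlowMor (fhom U Y) (fhom U Z) (mor0 f) post
    post_continuous post_src post_tgt post_pcomp.

Lemma fhom_mapE w u : fhom_app (morP fhom_map w) u = morP f (fhom_app w u).
Proof. by []. Qed.

End map.

Section restrict.
Variables (V U : cgType) (j : V -> U) (cj : continuous j) (Y : flow).

Let app_continuous (w : paths (fhom U Y)) :
  continuous (fun v => fhom_app w (j v)).
Proof. exact: comp_cont cj (@fhom_app_cont _ _ w). Qed.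

Let app_between (w : paths (fhom U Y)) (v : V) :
  src (fhom_app w (j v)) = src w /\ tgt (fhom_app w (j v)) = tgt w.
Proof. by rewrite src_fhom_app tgt_fhom_app. Qed.

Let pre (w : paths (fhom U Y)) : paths (fhom V Y) :=
  fhom_mk (@app_continuous w) (app_between w).

Let pre_src w : src (pre w) = src w.
Proof. by []. Qed.

Let pre_tgt w : tgt (pre w) = tgt w.
Proof. by []. Qed.

Let pre_continuous : continuous pre.
Proof.
apply: fhom_continuous; first exact: cg_k_space.
- exact: (@fhom_src_continuous U Y).
- exact: (@fhom_tgt_continuous U Y).
move=> K a b cK ca cb.
exact: (fhom_app_continuous cK ca (comp_cont cb cj)).
Qed.

Let pre_pcomp (x y : paths (fhom U Y)) (e : tgt x = src y)
  (e' : tgt (pre x) = src (pre y)) : pre (pcomp e) = pcomp e'.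
Proof.
by apply: fhom_ext => // v; rewrite /pre !fhom_mkE; exact: pcomp_eq.
Qed.

Definition fhom_restrict : flow_mor (fhom U Y) (fhom V Y) :=
  @FlowMor (fhom U Y) (fhom V Y) id pre
    pre_continuous pre_src pre_tgt pre_pcomp.

Lemma fhom_restrictE w v :
  fhom_app (morP fhom_restrict w) v = fhom_app w (j v).
Proof. by []. Qed.

End restrict.

Section eval.
Variables (U : cgType) (Y : flow) (u : U).

Let ev_continuous : continuous (fun w : paths (fhom U Y) => fhom_app w u).
Proof.
apply: cg_continuous => K v cK cv.
exact: (fhom_app_continuous cK cv (@cst_continuous _ _ u)).
Qed.

Let ev_pcomp (x y : paths (fhom U Y)) (e : tgt x = src y)
  (e' : tgt (fhom_app x u) = src (fhom_app y u)) :
  fhom_app (pcomp e) u = pcomp e'.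
Proof. exact: fhom_pcompE. Qed.

Definition fhom_eval : flow_mor (fhom U Y) Y :=
  @FlowMor (fhom U Y) Y id (fun w => fhom_app w u) ev_continuous
    (fun w => src_fhom_app w u) (fun w => tgt_fhom_app w u) ev_pcomp.

End eval.

End fhom_functor.

Section box.
Variables (U : cgType) (X : flow).

(* Formal composites of the paths [u ⊠ x], from which the left adjoint
   [U ⊠ -] of [{U, -}_S] is built. *)
Inductive word : skel X -> skel X -> Type :=
| word_gen (u : U) (x : paths X) : word (src x) (tgt x)
| word_comp a b c : word a b -> word b c -> word a c.

Section word_eval.
Variables (Y : flow) (g : flow_mor X (fhom U Y)).

Let between (a b : skel X) : Type :=
  {p : paths Y | src p = mor0 g a :> skel Y /\ tgt p = mor0 g b :> skel Y}.

Let eval_gen (u : U) (x : paths X) :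
  src (fhom_app (morP g x) u) = mor0 g (src x) :> skel Y /\
  tgt (fhom_app (morP g x) u) = mor0 g (tgt x) :> skel Y.
Proof.
by rewrite src_fhom_app tgt_fhom_app -(mor_src g x) -(mor_tgt g x).
Qed.

Let eval_compE a b c (p : between a b) (q : between b c) :
  tgt (sval p) = src (sval q).
Proof. by rewrite (svalP p).2 (svalP q).1. Qed.

Let eval_comp a b c (p : between a b) (q : between b c) :
  src (pcomp (eval_compE p q)) = mor0 g a :> skel Y /\
  tgt (pcomp (eval_compE p q)) = mor0 g c :> skel Y.
Proof. by rewrite src_pcomp tgt_pcomp (svalP p).1 (svalP q).2. Qed.

Fixpoint word_eval_between a b (w : word a b) : between a b :=
  match w with
  | word_gen u x => exist _ _ (eval_gen u x)
  | word_comp _ _ _ w1 w2 =>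
      exist _ _ (eval_comp (word_eval_between w1) (word_eval_between w2))
  end.

Definition word_eval a b (w : word a b) : paths Y := sval (word_eval_between w).

Lemma src_word_eval a b (w : word a b) : src (word_eval w) = mor0 g a.
Proof. exact: (svalP (word_eval_between w)).1. Qed.

Lemma tgt_word_eval a b (w : word a b) : tgt (word_eval w) = mor0 g b.
Proof. exact: (svalP (word_eval_between w)).2. Qed.

Lemma word_eval_comp a b c (w : word a b) (w' : word b c)
    (e : tgt (word_eval w) = src (word_eval w')) :
  word_eval (word_comp w w') = pcomp e.
Proof. exact: pcomp_eq. Qed.

End word_eval.

Definition words : Type := {ab : skel X * skel X & word ab.1 ab.2}.
HB.instance Definition _ := gen_eqMixin words.
HB.instance Definition _ := gen_choiceMixin words.

Definition in_words a b (w : word a b) : words :=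
  existT (fun ab => word ab.1 ab.2) (a, b) w.

(* Two formal composites are identified when every morphism [X -> {U, Y}_S]
   evaluates them equally; the topology is the compactly generated one whose
   test maps are those whose evaluations are all continuous. This is the left
   adjoint: [box_liftP] and [box_lift_unique] say that [box_unit] is a
   universal morphism from [X] to [{U, -}_S]. *)
Definition word_equiv (w w' : words) : Prop := projT1 w = projT1 w' /\
  forall (Y : flow) (g : flow_mor X (fhom U Y)),
    word_eval g (projT2 w) = word_eval g (projT2 w').

Let equiv (w w' : words) : bool := `[< word_equiv w w' >].

Let equiv_refl : reflexive equiv.
Proof. by move=> w; apply/asboolP. Qed.

Let equiv_sym : symmetric equiv.
Proof.
move=> w w'; apply/asboolP/asboolP => -[e E]; split=> // Y g;
  exact/esym/E.
Qed.

Let equiv_trans : transitive equiv.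
Proof.
move=> w' w w'' /asboolP[e E] /asboolP[e' E']; apply/asboolP; split.
  by rewrite e.
by move=> Y g; rewrite E.
Qed.

Definition word_equivb : equiv_rel words :=
  EquivRel equiv equiv_refl equiv_sym equiv_trans.

Definition box_set : choiceType := {eq_quot word_equivb}.

Definition box_src (q : box_set) : skel X := (projT1 (repr q)).1.
Definition box_tgt (q : box_set) : skel X := (projT1 (repr q)).2.
Definition box_eval (Y : flow) (g : flow_mor X (fhom U Y)) (q : box_set) :
  paths Y := word_eval g (projT2 (repr q)).

Definition box_paths : Type :=
  probed (fun (K : topologicalType) (v : K -> box_set) =>
    [/\ continuous (box_src \o v), continuous (box_tgt \o v) &
        forall (Y : flow) (g : flow_mor X (fhom U Y)),
          continuous (box_eval g \o v)]).
HB.instance Definition _ := Topological.on box_paths.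

Definition box_class a b (w : word a b) : box_paths :=
  \pi_({eq_quot word_equivb}) (in_words w).

Let repr_class a b (w : word a b) :
  word_equiv (repr (box_class w : box_set)) (in_words w).
Proof.
have : in_words w = repr (box_class w : box_set) %[mod {eq_quot word_equivb}].
  by rewrite reprK.
by move/eqmodP => /asboolP[e E]; split => // Y g; rewrite E.
Qed.

Lemma box_classP (q : box_paths) :
  exists a b (w : word a b), q = box_class w.
Proof.
exists (projT1 (repr (q : box_set))).1, (projT1 (repr (q : box_set))).2.
exists (projT2 (repr (q : box_set))).
rewrite /box_class /in_words; rewrite -[LHS]reprK; congr (\pi _).
by case: (repr _) => -[].
Qed.

Lemma box_src_class a b (w : word a b) : box_src (box_class w) = a.
Proof. by rewrite /box_src (repr_class w).1. Qed.

Lemma box_tgt_class a b (w : word a b) : box_tgt (box_class w) = b.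
Proof. by rewrite /box_tgt (repr_class w).1. Qed.

Lemma box_eval_class Y (g : flow_mor X (fhom U Y)) a b (w : word a b) :
  box_eval g (box_class w) = word_eval g w.
Proof. exact: (repr_class w).2. Qed.

Lemma box_ext (q q' : box_paths) :
  box_src q = box_src q' -> box_tgt q = box_tgt q' ->
  (forall Y (g : flow_mor X (fhom U Y)), box_eval g q = box_eval g q') ->
  q = q'.
Proof.
move=> eqs eqt eqg; rewrite -[q]reprK -[q']reprK; apply/eqmodP/asboolP.
split; last exact: eqg.
move: eqs eqt; rewrite /box_src /box_tgt.
by case: (projT1 (repr q)) (projT1 (repr q')) => ? ? [? ?] /= -> ->.
Qed.

Lemma box_src_continuous : continuous (box_src : box_paths -> skel X).
Proof. by apply: probed_continuousP => K v _ []. Qed.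

Lemma box_tgt_continuous : continuous (box_tgt : box_paths -> skel X).
Proof. by apply: probed_continuousP => K v _ []. Qed.

Lemma box_eval_continuous Y (g : flow_mor X (fhom U Y)) :
  continuous (box_eval g : box_paths -> paths Y).
Proof. by apply: probed_continuousP => K v _ [_ _]; apply. Qed.

Lemma box_continuous (S : topologicalType) (f : S -> box_paths) :
  k_space S -> continuous (fun s => box_src (f s)) ->
  continuous (fun s => box_tgt (f s)) ->
  (forall Y (g : flow_mor X (fhom U Y)),
     continuous (fun s => box_eval g (f s))) ->
  continuous f.
Proof.
move=> kS cs ct cg; apply: k_space_continuous => // K v cK cv.
apply: probe_continuous => //; split.
- exact: comp_cont cv cs.
- exact: comp_cont cv ct.
- by move=> Y g; exact: comp_cont cv (cg Y g).
Qed.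

Let box_weak_hausdorff : weak_hausdorff box_paths.
Proof.
apply: separated_weak_hausdorff; first exact: probed_k_space.
move=> q q' qq'.
have [eqs|] := pselect (box_src q = box_src q'); last first.
  move=> neq; exists (skel X), box_src; split => //.
    exact/hausdorff_weak_hausdorff/discrete_hausdorff.
  exact: box_src_continuous.
have [eqt|] := pselect (box_tgt q = box_tgt q'); last first.
  move=> neq; exists (skel X), box_tgt; split => //.
    exact/hausdorff_weak_hausdorff/discrete_hausdorff.
  exact: box_tgt_continuous.
apply: contrapT => nsep; apply: qq'; apply: box_ext => // Y g.
apply: contrapT => neq; apply: nsep; exists (paths Y), (box_eval g).
split => //; first exact: cg_weak_hausdorff.
exact: box_eval_continuous.
Qed.

HB.instance Definition _ :=
  isCG.Build box_paths (probed_k_space (P := _)) box_weak_hausdorff.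

Lemma src_box_eval Y (g : flow_mor X (fhom U Y)) (q : box_paths) :
  src (box_eval g q) = mor0 g (box_src q).
Proof. exact: src_word_eval. Qed.

Lemma tgt_box_eval Y (g : flow_mor X (fhom U Y)) (q : box_paths) :
  tgt (box_eval g q) = mor0 g (box_tgt q).
Proof. exact: tgt_word_eval. Qed.

Definition box_pcomp (q q' : box_paths) (e : box_tgt q = box_src q') :
    box_paths :=
  box_class (word_comp (projT2 (repr (q : box_set)))
    (ecast a (word a _) (esym e) (projT2 (repr (q' : box_set))))).

Let box_src_pcomp q q' (e : box_tgt q = box_src q') :
  box_src (box_pcomp e) = box_src q.
Proof. exact: box_src_class. Qed.

Let box_tgt_pcomp q q' (e : box_tgt q = box_src q') :
  box_tgt (box_pcomp e) = box_tgt q'.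
Proof. exact: box_tgt_class. Qed.

Lemma box_eval_pcomp Y (g : flow_mor X (fhom U Y)) q q'
    (e : box_tgt q = box_src q')
    (e' : tgt (box_eval g q) = src (box_eval g q')) :
  box_eval g (box_pcomp e) = pcomp e'.
Proof.
rewrite box_eval_class.
have E a (e1 : box_src q' = a) :
    word_eval g (ecast a (word a _) e1 (projT2 (repr (q' : box_set)))) =
    box_eval g q' by case: _ / e1.
rewrite word_eval_comp => [|e2]; first by rewrite E.
by apply: pcomp_eq => //; exact: E.
Qed.

Lemma box_pcomp_class a b c (w : word a b) (w' : word b c)
    (e : box_tgt (box_class w) = box_src (box_class w')) :
  box_pcomp e = box_class (word_comp w w').
Proof.
apply: box_ext.
- by rewrite box_src_pcomp !box_src_class.
- by rewrite box_tgt_pcomp !box_tgt_class.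
move=> Y g; have e1 : tgt (word_eval g w) = src (word_eval g w').
  by rewrite tgt_word_eval src_word_eval.
have e2 : tgt (box_eval g (box_class w)) = src (box_eval g (box_class w')).
  by rewrite !box_eval_class.
rewrite (box_eval_pcomp _ e2) [RHS]box_eval_class (word_eval_comp e1).
by apply: pcomp_eq; rewrite box_eval_class.
Qed.

Let box_pcomp_continuous : continuous
  (fun p : @composable box_paths _ box_src box_tgt => box_pcomp (kvalP p)).
Proof.
pose CP := @composable box_paths _ box_src box_tgt.
have c1 : continuous (fun p : CP => (kval p).1).
  exact: (comp_cont (@kval_continuous _ _) (@kfst_continuous _ _)).
have c2 : continuous (fun p : CP => (kval p).2).
  exact: (comp_cont (@kval_continuous _ _) (@ksnd_continuous _ _)).
apply: box_continuous; first exact: cg_k_space.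
- rewrite (_ : (fun p => _) = fun p : CP => box_src (kval p).1).
    exact: comp_cont c1 box_src_continuous.
  by apply/funext => p; exact: box_src_pcomp.
- rewrite (_ : (fun p => _) = fun p : CP => box_tgt (kval p).2).
    exact: comp_cont c2 box_tgt_continuous.
  by apply/funext => p; exact: box_tgt_pcomp.
move=> Y g.
have E (p : CP) :
    tgt (box_eval g (kval p).1) = src (box_eval g (kval p).2).
  by rewrite tgt_box_eval src_box_eval (kvalP p).
rewrite (_ : (fun p => _) = fun p : CP => pcomp (E p)).
  apply: pcomp_pair_continuous; first exact: cg_k_space.
  - exact: comp_cont c1 (@box_eval_continuous Y g).
  - exact: comp_cont c2 (@box_eval_continuous Y g).
by apply/funext => p; exact: box_eval_pcomp.
Qed.

Let box_pcompA (x y z : box_paths) (xy : box_tgt x = box_src y)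
    (yz : box_tgt y = box_src z) (xy_z : box_tgt (box_pcomp xy) = box_src z)
    (x_yz : box_tgt x = box_src (box_pcomp yz)) :
  box_pcomp xy_z = box_pcomp x_yz.
Proof.
apply: box_ext.
- by rewrite !box_src_pcomp.
- by rewrite !box_tgt_pcomp.
move=> Y g.
have E q q' : box_tgt q = box_src q' ->
    tgt (box_eval g q) = src (box_eval g q').
  by move=> e; rewrite tgt_box_eval src_box_eval e.
rewrite (box_eval_pcomp _ (E _ _ xy_z)) (box_eval_pcomp _ (E _ _ x_yz)).
have e1 := E _ _ xy; have e2 := E _ _ yz.
have e3 : tgt (pcomp e1) = src (box_eval g z) by rewrite tgt_pcomp.
have e4 : tgt (box_eval g x) = src (pcomp e2) by rewrite src_pcomp.
transitivity (pcomp e3); first by apply: pcomp_eq => //; exact: box_eval_pcomp.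
rewrite (pcompA e3 e4).
by apply: pcomp_eq => //; apply/esym; exact: box_eval_pcomp.
Qed.

Definition box : flow := @Flow (skel X) box_paths box_src box_tgt
  box_src_continuous box_tgt_continuous box_pcomp box_pcomp_continuous
  box_src_pcomp box_tgt_pcomp box_pcompA.

Section unit.

Let gen (x : paths X) (u : U) : paths box := box_class (word_gen u x).

Let gen_continuous x : continuous (gen x).
Proof.
apply: box_continuous; first exact: cg_k_space.
- rewrite (_ : (fun u => _) = cst (src x)); first exact: cst_continuous.
  by apply/funext => u; exact: box_src_class.
- rewrite (_ : (fun u => _) = cst (tgt x)); first exact: cst_continuous.
  by apply/funext => u; exact: box_tgt_class.
move=> Y g; rewrite (_ : (fun u => _) = fhom_app (morP g x)).
  exact: fhom_app_cont.
by apply/funext => u; exact: box_eval_class.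
Qed.

Let gen_between x u : src (gen x u) = src x /\ tgt (gen x u) = tgt x.
Proof. by split; [exact: box_src_class|exact: box_tgt_class]. Qed.

Let unitP (x : paths X) : paths (fhom U box) :=
  fhom_mk (@gen_continuous x) (gen_between x).

Let unit_src x : src (unitP x) = src x.
Proof. by []. Qed.

Let unit_tgt x : tgt (unitP x) = tgt x.
Proof. by []. Qed.

Let unit_continuous : continuous unitP.
Proof.
apply: fhom_continuous; first exact: cg_k_space.
- exact: src_continuous.
- exact: tgt_continuous.
move=> K a b cK ca cb; apply: box_continuous.
- exact: compact_hausdorff_k_space.
- rewrite (_ : (fun u => _) = fun k => src (a k)).
    exact: comp_cont ca (@src_continuous X).
  by apply/funext => k; exact: box_src_class.
- rewrite (_ : (fun u => _) = fun k => tgt (a k)).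
    exact: comp_cont ca (@tgt_continuous X).
  by apply/funext => k; exact: box_tgt_class.
move=> Y g.
rewrite (_ : (fun u => _) = fun k => fhom_app (morP g (a k)) (b k)).
  apply: fhom_app_continuous => //.
  exact: comp_cont ca (@morP_continuous _ _ g).
by apply/funext => k; exact: box_eval_class.
Qed.

Let unit_pcomp (x y : paths X) (e : tgt x = src y)
  (e' : tgt (unitP x) = src (unitP y)) : unitP (pcomp e) = pcomp e'.
Proof.
apply: fhom_ext; rewrite /fhom_src /fhom_tgt/=.
- exact: src_pcomp.
- exact: tgt_pcomp.
move=> u; rewrite !fhom_mkE.
have e1 : box_tgt (gen x u) = box_src (gen y u).
  by rewrite box_tgt_class box_src_class.
transitivity (box_pcomp e1); last by congr box_pcomp; exact: Prop_irrelevance.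
apply: box_ext.
- by rewrite box_src_pcomp !box_src_class src_pcomp.
- by rewrite box_tgt_pcomp !box_tgt_class tgt_pcomp.
move=> Y g.
have e2 : tgt (box_eval g (gen x u)) = src (box_eval g (gen y u)).
  by rewrite tgt_box_eval src_box_eval e1.
rewrite (box_eval_pcomp _ e2) [LHS]box_eval_class /word_eval/=.
have e3 : tgt (morP g x) = src (morP g y) by rewrite mor_tgt mor_src e.
have e4 : tgt (fhom_app (morP g x) u) = src (fhom_app (morP g y) u).
  by rewrite tgt_fhom_app src_fhom_app.
rewrite (mor_pcomp e e3).
rewrite (@fhom_pcompE U Y (morP g x) (morP g y) e3 u e4).
by apply: pcomp_eq; rewrite box_eval_class.
Qed.

Definition box_unit : flow_mor X (fhom U box) :=
  @FlowMor X (fhom U box) id unitP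
    unit_continuous unit_src unit_tgt unit_pcomp.

Lemma box_unitE x u : fhom_app (morP box_unit x) u = box_class (word_gen u x).
Proof. by []. Qed.

End unit.

Section lift.
Variables (Y : flow) (g : flow_mor X (fhom U Y)).

Let lift_pcomp (q q' : paths box) (e : tgt q = src q')
  (e' : tgt (box_eval g q) = src (box_eval g q')) :
  box_eval g (pcomp e) = pcomp e'.
Proof. exact: box_eval_pcomp. Qed.

Definition box_lift : flow_mor box Y :=
  @FlowMor box Y (mor0 g) (box_eval g) (@box_eval_continuous Y g)
    (src_box_eval g) (tgt_box_eval g) lift_pcomp.

Lemma box_liftP : mor_comp (fhom_map U box_lift) box_unit = g.
Proof.
apply: flow_mor_ext => //= x; apply: fhom_ext.
- exact/esym/(mor_src g x).
- exact/esym/(mor_tgt g x).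
by move=> u; rewrite fhom_mkE box_unitE; exact: box_eval_class.
Qed.

Lemma box_lift_unique (k : flow_mor box Y) :
  mor_comp (fhom_map U k) box_unit = g -> k = box_lift.
Proof.
move=> kg; have k0 a : mor0 k a = mor0 g a by rewrite -kg.
apply: flow_mor_ext => // q; have [a [b [w ->{q}]]] := box_classP q.
rewrite /= box_eval_class; elim: w => {a b} [u x|a b c w IHw w' IHw'].
  by rewrite -kg.
have e : box_tgt (box_class w) = box_src (box_class w').
  by rewrite box_tgt_class box_src_class.
rewrite -(box_pcomp_class e).
have e1 : tgt (morP k (box_class w)) = src (morP k (box_class w')).
  by rewrite mor_tgt mor_src /= e.
rewrite (mor_pcomp (X := box) e e1).
by rewrite word_eval_comp ?tgt_word_eval ?src_word_eval// => e2; exact: pcomp_eq.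
Qed.

End lift.

End box.

(* Functoriality of [U ⊠ X] in [U]. *)
Section box_functor.
Variables (V U : cgType) (j : V -> U) (cj : continuous j) (X : flow).

Definition box_map : flow_mor (box V X) (box U X) :=
  box_lift (mor_comp (fhom_restrict cj (box U X)) (box_unit U X)).

End box_functor.

Section mor_id.
Variable X : flow.

Let id_cont : continuous (id : paths X -> paths X).
Proof. by move=> x; exact: cvg_id. Qed.

Let id_pcomp (x y : paths X) (e e' : tgt x = src y) : pcomp e = pcomp e'.
Proof. exact: pcomp_eq. Qed.

Definition mor_id : flow_mor X X :=
  @FlowMor X X id id id_cont (fun=> erefl) (fun=> erefl) id_pcomp.

End mor_id.

Definition point_space : Type := discrete_topology unit.
HB.instance Definition _ := DiscreteTopology.on point_space.

Lemma point_space_compact_hausdorff : compact_hausdorff point_space.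
Proof.
split; last exact: discrete_hausdorff.
by apply: finite_compact; exact: finite_finset.
Qed.

HB.instance Definition _ := isCG.Build point_space
  (compact_hausdorff_k_space point_space_compact_hausdorff)
  (hausdorff_weak_hausdorff point_space_compact_hausdorff.2).

Section box_point.
Variable X : flow.

(* The isomorphism [X -> {*} ⊠ X]; see [box_pt_iso]. *)
Definition box_pt : flow_mor X (box point_space X) :=
  mor_comp (fhom_eval (box point_space X) (tt : point_space))
    (box_unit point_space X).

Let const (x : paths X) : paths (fhom point_space X) :=
  @fhom_mk point_space X (src x) (tgt x) (cst x) (@cst_continuous _ _ x)
    (fun=> conj erefl erefl).

Let const_continuous : continuous const.
Proof.
apply: fhom_continuous; first exact: cg_k_space.
- exact: src_continuous.
- exact: tgt_continuous.
- by [].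
Qed.

Let const_pcomp (x y : paths X) (e : tgt x = src y)
  (e' : tgt (const x) = src (const y)) : const (pcomp e) = pcomp e'.
Proof.
apply: fhom_ext; [exact: src_pcomp|exact: tgt_pcomp|].
by move=> u; rewrite !fhom_mkE; exact: pcomp_eq.
Qed.

Definition box_pt_inv : flow_mor (box point_space X) X :=
  box_lift (@FlowMor X (fhom point_space X) id const const_continuous
    (fun=> erefl) (fun=> erefl) const_pcomp).

Lemma box_pt_iso :
  mor_comp box_pt_inv box_pt = mor_id X /\
  mor_comp box_pt box_pt_inv = mor_id (box point_space X).
Proof.
split; first by apply: flow_mor_ext => // x; exact: box_eval_class.
rewrite (@box_lift_unique _ _ _ (box_unit point_space X) (mor_id _)).
  apply: box_lift_unique; apply: flow_mor_ext => // x.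
  apply: fhom_ext => // -[]; rewrite /= fhom_mkE.
  by rewrite box_unitE (box_eval_class (Y := X)).
by apply: flow_mor_ext => // x; exact: fhom_ext.
Qed.

End box_point.

(* [x |-> u ⊠ x], on states and on paths. *)
Definition box_at (U : cgType) (u : U) (X : flow) : flow_mor X (box U X) :=
  mor_comp
    (box_map (j := (fun=> u) : point_space -> U) (@cst_continuous _ _ u) X)
    (box_pt X).

Lemma box_atE (U : cgType) (u : U) (X : flow) :
  box_at u X = mor_comp (fhom_eval (box U X) u) (box_unit U X).
Proof. by apply: flow_mor_ext => // x; exact: box_eval_class. Qed.

(* The states [0] and [1] are [false] and [true]. *)
Section glob.
Variable Z : cgType.

Let glob_src (z : Z) : bool := false.
Let glob_tgt (z : Z) : bool := true.

Let glob_tgt_neq_src (x y : Z) : glob_tgt x = glob_src y -> False.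
Proof. by []. Qed.

Let glob_pcomp (x y : Z) (e : glob_tgt x = glob_src y) : Z :=
  False_rect Z (glob_tgt_neq_src e).

Let glob_pcomp_continuous : continuous
  (fun p : composable glob_src glob_tgt => glob_pcomp (kvalP p)).
Proof. by move=> p; have := kvalP p. Qed.

Let glob_srcP (x y : Z) (e : glob_tgt x = glob_src y) :
  glob_src (glob_pcomp e) = glob_src x.
Proof. by []. Qed.

Let glob_tgtP (x y : Z) (e : glob_tgt x = glob_src y) :
  glob_tgt (glob_pcomp e) = glob_tgt y.
Proof. by []. Qed.

Let glob_pcompA (x y z : Z) (xy : glob_tgt x = glob_src y)
    (yz : glob_tgt y = glob_src z) (xy_z : glob_tgt (glob_pcomp xy) = glob_src z)
    (x_yz : glob_tgt x = glob_src (glob_pcomp yz)) :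
  glob_pcomp xy_z = glob_pcomp x_yz.
Proof. by []. Qed.

Definition glob : flow := @Flow bool Z glob_src glob_tgt
  (@cst_continuous _ _ _) (@cst_continuous _ _ _)
  glob_pcomp glob_pcomp_continuous glob_srcP glob_tgtP glob_pcompA.

End glob.

Section glob_map.
Variables (Z Z' : cgType) (f : Z -> Z') (cf : continuous f).

Let glob_map_pcomp (x y : paths (glob Z)) (e : tgt x = src y)
    (e' : tgt (f x : paths (glob Z')) = src (f y : paths (glob Z'))) :
  f (pcomp e) = pcomp e'.
Proof. by []. Qed.

Definition glob_map : flow_mor (glob Z) (glob Z') :=
  @FlowMor (glob Z) (glob Z') id f cf
    (fun=> erefl) (fun=> erefl) glob_map_pcomp.

End glob_map.

Definition glob_incl (Z : cgType) (A : set Z) :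
    flow_mor (glob (ksub A)) (glob Z) :=
  glob_map (@kval_continuous Z A).

Definition NDR_pair (R : realType) (Z : cgType) (A : set Z) : Prop :=
  exists (u : Z -> unit_interval R) (h : kprod Z (unit_interval R) -> Z),
    [/\ continuous u /\ continuous h,
        A = [set z | u z = I0 R],
        forall z, h (z, I0 R) = z,
        forall a t, A a -> h (a, t) = a &
        forall z, set_val (u z) < 1 -> A (h (z, I1 R))].

(* By [flow_mor_ext], an equation between morphisms is an equation at every
   state and at every path. *)
Definition SHEP (R : realType) (A X : flow) (i : flow_mor A X) : Prop :=
  synchronized i /\
  forall (Y : flow) (f : flow_mor X Y)
      (h : flow_mor (box (unit_interval R) A) Y),
    mor_comp h (box_at (I0 R) A) = mor_comp f i ->
    exists H : flow_mor (box (unit_interval R) X) Y,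
      mor_comp H (box_at (I0 R) X) = f /\
      forall t : unit_interval R,
        mor_comp (mor_comp H (box_at t X)) i = mor_comp h (box_at t A).

(* Main.v *)
Require Import Defs.
From mathcomp Require Import all_boot all_order all_algebra.
From mathcomp Require Import all_classical all_reals topology normedtype.
From mathcomp Require Import lra.

Set Implicit Arguments.
Unset Strict Implicit.
Unset Printing Implicit Defensive.

Import Order.TTheory GRing.Theory Num.Theory.
Import numFieldNormedType.Exports.

Local Open Scope classical_set_scope.
Local Open Scope ring_scope.

(** Since the only paths of a globe are its generators, a morphism out of
    [U ⊠ Glob(Z)] amounts to a pair of states [a], [b] together with a
    continuous map from [Z * U] to the space of paths from [a] to [b]
    ([glob_homotopy] in one direction, [box_at_continuous] in the other). The
    S-homotopy extension property of the inclusion of globes is therefore the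
    ordinary homotopy extension property of the pair [(Z, dZ)], with values in
    one space of paths ([NDR_homotopy_extension]).

    For an NDR pair, given by [u] and [h], that property follows from a
    retraction of [Z * I] onto [Z * {0}] union [dZ * I]. It sends [(z, t)] to
    [(h (z, t / u z), 0)] when [t <= u z], and to [(h (z, 1), t - u z)] when
    [t >= u z]: if [t > u z] then [u z < 1], so that [h (z, 1)] lies in [dZ].
    The delicate point is the continuity of the first coordinate where [u]
    vanishes and the quotient [t / u z] has no limit
    ([NDR_retraction]). There [z] lies in [dZ] and [h (z, s)] does not depend on
    [s]; so the first coordinate is [h (z, s)] for every solution [s] in [I] of
    [s * u z = min t (u z)]. Continuity may be tested along a compact Hausdorff
    space [K]; the solution set is closed in the compact space [K * I], hence
    [K] is a quotient of it, and on it the map is visibly continuous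
    ([quotient_continuous]). *)

(** * Continuity on compact Hausdorff spaces *)

(** A continuous surjection from a compact space to a Hausdorff space is closed,
    hence a quotient map. *)
Lemma quotient_continuous (M K T : topologicalType) (p : M -> K) (g : K -> T) :
  compact [set: M] -> hausdorff_space K -> continuous p -> range p = setT ->
  continuous (g \o p) -> continuous g.
Proof.
move=> cM hK cp pT /continuous_closedP cgp; apply/continuous_closedP => V cV.
have -> : g @^-1` V = p @` ((g \o p) @^-1` V).
  rewrite comp_preimage; apply/esym/image_preimage; exact: pT.
apply: compact_closed => //; apply: continuous_compact.
  exact: continuous_subspaceT.
by apply: (subclosed_compact _ cM) => //; exact: cgp.
Qed.

Lemma closed_pasting (K T : topologicalType) (g : K -> T) (C D : set K) :
  compact_hausdorff K -> closed C -> closed D -> C `|` D = setT ->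
  continuous (fun c : set_type C => g (set_val c)) ->
  continuous (fun d : set_type D => g (set_val d)) -> continuous g.
Proof.
move=> cK cC cD CD cgC cgD; apply/continuous_closedP => V cV.
have closed_part (E : set K) : closed E ->
    continuous (fun c : set_type E => g (set_val c)) -> closed (E `&` g @^-1` V).
  move=> cE /continuous_closedP/(_ _ cV) cgV.
  have -> : E `&` g @^-1` V =
      set_val @` [set c : set_type E | V (g (set_val c))].
    apply/seteqP; split => [x [Ex Vx]|_ [c Vc <-]].
      by exists (exist _ x (mem_set Ex)).
    by split => //; exact: set_valP.
  have [cptE _] := closed_compact_hausdorff cK cE.
  apply: compact_closed; first exact: cK.2.
  apply: continuous_compact; first exact/continuous_subspaceT/initial_continuous.
  exact: (subclosed_compact cgV cptE).
rewrite -[g @^-1` V]setTI -CD setIUl.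
by apply: closedU; exact: closed_part.
Qed.

(** * The unit interval and real functions *)

Section unit_interval.
Variable R : realType.
Local Notation I := (unit_interval R).

Lemma unit_interval_ge0 (t : I) : 0 <= set_val t.
Proof. by have /= := set_valP t; rewrite in_itv/= => /andP[]. Qed.

Lemma unit_interval_le1 (t : I) : set_val t <= 1.
Proof. by have /= := set_valP t; rewrite in_itv/= => /andP[]. Qed.

Lemma unit_interval_mk (x : R) : 0 <= x <= 1 -> exists t : I, set_val t = x.
Proof.
move=> x01; have Ix : `[0 : R, 1]%classic x by rewrite /= in_itv.
by exists (exist _ x (mem_set Ix)).
Qed.

Lemma unit_interval_val_continuous : continuous (set_val : I -> R).
Proof. exact: initial_continuous. Qed.

Lemma unit_interval_continuous (S : topologicalType) (f : S -> I) :
  continuous (fun s => set_val (f s) : R) -> continuous f.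
Proof. exact: (@initial_topology_continuous _ _ _ set_val). Qed.

End unit_interval.

Section real_functions.
Variables (R : realType) (S : topologicalType) (f g : S -> R).
Hypotheses (cf : continuous f) (cg : continuous g).

Lemma sub_continuous : continuous (fun x => f x - g x).
Proof. by move=> x; apply: cvgB; [exact: cf|exact: cg]. Qed.

Lemma mul_continuous : continuous (fun x => f x * g x).
Proof. by move=> x; apply: cvgM; [exact: cf|exact: cg]. Qed.

Lemma min_continuous : continuous (fun x => Num.min (f x) (g x)).
Proof. by move=> x; apply: continuous_min; [exact: cf|exact: cg]. Qed.

Lemma max_continuous : continuous (fun x => Num.max (f x) (g x)).
Proof. by move=> x; apply: continuous_max; [exact: cf|exact: cg]. Qed.

End real_functions.

(** * Homotopy extension for NDR pairs *)

Lemma NDR_closed (R : realType) (Z : cgType) (A : set Z) :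
  NDR_pair R A -> closed A.
Proof.
move=> [u [h [[cu _] -> _ _ _]]].
apply: (preimage_closed (f := u) (D := [set I0 R])) => [x _|]; first exact: cu.
apply/accessible_closed_set1/hausdorff_accessible.
exact: (unit_interval_compact_hausdorff R).2.
Qed.

(** The pair [(r, m)] is a retraction of [Z * I] onto [Z * {0}] union [A * I];
    the last clause says that its values lie in this union. *)
Lemma NDR_retraction (R : realType) (Z : cgType) (A : set Z) :
  NDR_pair R A ->
  exists (r : kprod Z (unit_interval R) -> Z)
         (m : kprod Z (unit_interval R) -> unit_interval R),
    [/\ continuous r /\ continuous m,
        forall z, r (z, I0 R) = z /\ m (z, I0 R) = I0 R,
        forall a t, A a -> r (a, t) = a /\ m (a, t) = t &
        forall p, m p = I0 R \/ A (r p)].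
Proof.
move=> [u [h [[cu ch] AE h0 hA h1]]]; pose I := unit_interval R.
pose tau (p : kprod Z I) : R := set_val p.2.
pose v (p : kprod Z I) : R := set_val (u p.1).
have tau0 p : 0 <= tau p by exact: unit_interval_ge0.
have v0 p : 0 <= v p by exact: unit_interval_ge0.
have tau1 p : tau p <= 1 by exact: unit_interval_le1.
have v1 p : v p <= 1 by exact: unit_interval_le1.
have vA p : v p = 0 -> A p.1.
  by move=> vp; rewrite AE; apply: val_inj; exact: vp.
have ctau : continuous tau.
  exact: comp_cont (@ksnd_continuous _ _) (@unit_interval_val_continuous R).
have cv : continuous v.
  apply: comp_cont (@unit_interval_val_continuous R).
  exact: comp_cont (@kfst_continuous _ _) cu.
(* Where [v p] vanishes, any value of [s p] would do. *)
have /choice[s sP] : forall p, exists s : I,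
    set_val s * v p = Num.min (tau p) (v p).
  move=> p; have [vp|vp] := eqVneq (v p) 0.
    by exists (I0 R); rewrite vp mulr0 min_r.
  have vpos : 0 < v p by rewrite lt_neqAle eq_sym vp v0.
  have [|t tE] := @unit_interval_mk R (Num.min (tau p) (v p) / v p).
    by rewrite divr_ge0 ?le_min ?tau0 ?v0//= ler_pdivrMr// mul1r ge_min lexx orbT.
  by exists t; rewrite tE divfK.
have /choice[m mP] : forall p, exists m : I,
    set_val m = Num.max (tau p - v p) 0.
  move=> p; apply: unit_interval_mk.
  rewrite le_max lexx orbT/= ge_max ler01 andbT.
  by have := tau1 p; have := v0 p; lra.
(* Uniqueness up to [h]: this makes the first coordinate descend from the
   solution set of the equation for [s] to [Z * I]. *)
have sU p (t : I) : set_val t * v p = Num.min (tau p) (v p) ->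
    h (p.1, t) = h (p.1, s p).
  move=> tE; have [vp|vp] := eqVneq (v p) 0.
    by rewrite !hA//; exact: vA.
  congr (h (_, _)); apply: val_inj; apply: (mulIf vp).
  exact: eq_trans tE (esym (sP p)).
exists (fun p => h (p.1, s p)), m; split.
- split; last first.
    apply: unit_interval_continuous.
    rewrite (_ : (fun p => _) = fun p => Num.max (tau p - v p) 0); last first.
      by apply/funext => p; exact: mP.
    apply: max_continuous; last exact: cst_continuous.
    exact: sub_continuous ctau cv.
  apply: cg_continuous => K w cK cw.
  (* Solutions of the equation for [s] over [K]; [E] projects onto [K]. *)
  pose E : set (K * I) :=
    [set q | set_val q.2 * v (w q.1) - Num.min (tau (w q.1)) (v (w q.1)) = 0].
  have cE : closed E.
    have cw1 : continuous (fun q : K * I => w q.1).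
      exact: (comp_cont (@fst_continuous K I) cw).
    have cs : continuous (fun q : K * I => set_val q.2 : R).
      exact: (comp_cont (@snd_continuous K I) (@unit_interval_val_continuous R)).
    have cvw := comp_cont cw1 cv; have ctauw := comp_cont cw1 ctau.
    have cD := sub_continuous (mul_continuous cs cvw)
      (min_continuous ctauw cvw).
    by apply: (preimage_closed (D := [set x : R | x = 0]) _ (@closed_eq _ 0))
      => q _; exact: cD.
  have cKI := prod_compact_hausdorff cK (unit_interval_compact_hausdorff R).
  have cptE := closed_compact_hausdorff cKI cE.
  have cE1 : continuous (fun e : set_type E => (set_val e).1).
    exact: (comp_cont (@initial_continuous _ _ _) (@fst_continuous _ _)).
  apply: (quotient_continuous (p := fun e : set_type E => (set_val e).1)
    cptE.1 cK.2 cE1).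
    apply/seteqP; split => // x _.
    have Ex : E (x, s (w x)) by rewrite /E/= sP subrr.
    by exists (exist _ (x, s (w x)) (mem_set Ex)).
  rewrite (_ : _ \o _ = fun e : set_type E =>
      h ((w (set_val e).1).1, (set_val e).2)); last first.
    apply/funext => e /=; apply/esym/sU.
    by have /= := set_valP e; rewrite /E/= => /subr0_eq.
  apply: comp_cont ch; apply: kpair_continuous.
  + exact: compact_hausdorff_k_space.
  + exact: comp_cont (comp_cont cE1 cw) (@kfst_continuous _ _).
  + exact: comp_cont (@initial_continuous _ _ _) (@snd_continuous _ _).
- move=> z; split.
    rewrite -(sU (z, I0 R) (I0 R)) ?h0//.
    by rewrite mul0r min_l// /tau.
  by apply: val_inj; apply: eq_trans (mP _) _; rewrite /tau/= max_r// sub0r oppr_le0.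
- move=> a t Aa; split; first exact: hA.
  apply: val_inj; apply: eq_trans (mP _) _.
  have -> : v (a, t) = 0 by move: Aa; rewrite AE /v/= => ->.
  by rewrite subr0 max_l.
- move=> p; have [tv|vt] := leP (tau p) (v p).
    left; apply: val_inj; apply: eq_trans (mP _) _.
    by rewrite max_r// subr_le0.
  (* Here [min (tau p) (v p) = v p], which is solved by [1]. *)
  right; rewrite -(sU p (I1 R)); last by rewrite mul1r min_r// ltW.
  by apply: h1; exact: lt_le_trans vt (tau1 p).
Qed.

(** The extension is [f] on [Z * {0}] and [k] on [A * I], composed with the
    retraction. Both pieces are closed, so the composite is pasted from its
    restrictions to their preimages. *)
Lemma NDR_homotopy_extension (R : realType) (Z : cgType) (A : set Z)
    (P : topologicalType) (f : Z -> P)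
    (k : kprod (ksub A) (unit_interval R) -> P) :
  NDR_pair R A -> continuous f -> continuous k ->
  (forall a, k (a, I0 R) = f (kval a)) ->
  exists F : kprod Z (unit_interval R) -> P,
    [/\ continuous F, forall z, F (z, I0 R) = f z &
        forall a t, F (kval a, t) = k (a, t)].
Proof.
move=> ndr cf ck kf; have clA := NDR_closed ndr.
have [r [m [[cr cm] rm0 rmA rmP]]] := NDR_retraction ndr.
pose F p := if pselect (A (r p)) is left Ar then k (kmk Ar, m p) else f (r p).
have Fk p (Ar : A (r p)) : F p = k (kmk Ar, m p).
  rewrite /F; case: pselect => [Ar'|//].
  by congr (k (_, _)); exact: kval_inj.
have Ff p : m p = I0 R -> F p = f (r p).
  by move=> mp; rewrite /F; case: pselect => // Ar; rewrite mp kf.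
exists F; split.
- apply: cg_continuous => K w cK cw.
  have cmw := comp_cont cw cm; have crw := comp_cont cw cr.
  have cC : closed ((fun x => m (w x)) @^-1` [set I0 R]).
    apply: preimage_closed => [x _|]; first exact: cmw.
    apply/accessible_closed_set1/hausdorff_accessible.
    exact: (unit_interval_compact_hausdorff R).2.
  have cD : closed ((fun x => r (w x)) @^-1` A).
    by apply: preimage_closed => // x _; exact: crw.
  apply: (closed_pasting cK cC cD).
  + by apply/seteqP; split => // x _; exact: rmP.
  + rewrite (_ : (fun c => _) = fun c => f (r (w (set_val c)))).
      apply: comp_cont cf; apply: comp_cont crw; exact: initial_continuous.
    by apply/funext => c; apply: Ff; exact: (set_valP c).
  + have kD := compact_hausdorff_k_space (closed_compact_hausdorff cK cD).
    have Dr (d : set_type ((fun x => r (w x)) @^-1` A)) :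
        A (r (w (set_val d))) by exact: (set_valP d).
    rewrite (_ : (fun d => _) = fun d => k (kmk (Dr d), m (w (set_val d)))).
      apply: comp_cont ck; apply: kpair_continuous => //.
        apply: ksub_continuous => //.
        exact: comp_cont (@initial_continuous _ _ _) crw.
      exact: comp_cont (@initial_continuous _ _ _) cmw.
    by apply/funext => d; exact: Fk.
- by move=> z; rewrite Ff ?(rm0 z).2// (rm0 z).1.
- move=> a t; have [ra ma] := rmA _ t (kvalP a).
  have Ar : A (r (kval a, t)) by rewrite ra; exact: kvalP.
  by rewrite (Fk _ Ar) ma; congr (k (_, _)); exact: kval_inj.
Qed.

(** * Morphisms out of [U ⊠ Glob(Z)] *)

Section glob_homotopy.
Variables (U Z : cgType) (Y : flow) (a b : skel Y).
Variables (F : kprod Z U -> paths_between a b) (cF : continuous F).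

Let slice_continuous z : continuous (fun t => kval (F (z, t))).
Proof.
apply: comp_cont (@kval_continuous _ _); apply: comp_cont cF.
apply: kpair_continuous; first exact: cg_k_space.
  exact: cst_continuous.
by move=> t; exact: cvg_id.
Qed.

Let slice (z : Z) : paths (fhom U Y) :=
  fhom_mk (@slice_continuous z) (fun t => kvalP (F (z, t))).

Let slice_cont : continuous slice.
Proof.
apply: fhom_continuous; [exact: cg_k_space|exact: cst_continuous..|].
move=> K c d cK cc cd; apply: comp_cont (@kval_continuous _ _).
apply: comp_cont cF; apply: kpair_continuous => //.
exact: compact_hausdorff_k_space.
Qed.

Let slice_pcomp (x y : paths (glob Z)) (e : tgt x = src y)
  (e' : tgt (slice x) = src (slice y)) : slice (Defs.pcomp e) = Defs.pcomp e'.
Proof. by []. Qed.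

(** Adjoint to the morphism from [Glob(Z)] to [{U, Y}_S] that sends [z] to
    [F (z, -)]. *)
Definition glob_homotopy : flow_mor (box U (glob Z)) Y :=
  box_lift (@FlowMor (glob Z) (fhom U Y) (fun e : bool => if e then b else a) slice
    slice_cont (fun=> erefl) (fun=> erefl) slice_pcomp).

Lemma glob_homotopyE (t : U) (z : paths (glob Z)) :
  morP (mor_comp glob_homotopy (box_at t (glob Z))) z = kval (F (z, t)).
Proof. by rewrite box_atE; exact: box_eval_class. Qed.

End glob_homotopy.

(** Joint continuity of [(x, u) |-> h (u ⊠ x)]: by adjunction [h] is a continuous
    family of maps from [U], and evaluation is continuous along compact Hausdorff
    spaces. *)
Lemma box_at_continuous (U : cgType) (X Y : flow) (h : flow_mor (box U X) Y) :
  continuous (fun p : kprod (paths X) U => morP (mor_comp h (box_at p.2 X)) p.1).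
Proof.
apply: cg_continuous => K v cK cv; apply: comp_cont (@morP_continuous _ _ h).
rewrite (_ : (fun p => _) =
  fun x => fhom_app (morP (box_unit U X) (v x).1) (v x).2); last first.
  by apply/funext => x; rewrite box_atE.
apply: fhom_app_continuous => //.
  exact: comp_cont (comp_cont cv (@kfst_continuous _ _))
    (@morP_continuous _ _ (box_unit U X)).
exact: comp_cont cv (@ksnd_continuous _ _).
Qed.

(** * The S-homotopy extension property *)

Theorem theorem9p5 (R : realType) (Z : cgType) (dZ : set Z) :
  NDR_pair R dZ -> SHEP R (glob_incl dZ).
Proof.
move=> ndr; split; first by exists id.
move=> Y f h hf; pose I := unit_interval R.
have h0 t e : mor0 (mor_comp h (box_at t (glob (ksub dZ)))) e = mor0 f e.
  by have /(congr1 (fun g => mor0 g e)) := hf.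
(* Both [f] and [h] take values in one space of paths, because they agree on
   states. *)
have fab (z : Z) : src (morP f (z : paths (glob Z))) = mor0 f false /\
    tgt (morP f (z : paths (glob Z))) = mor0 f true.
  by rewrite mor_src mor_tgt.
have hab (p : kprod (ksub dZ) I) :
    src (morP (mor_comp h (box_at p.2 (glob (ksub dZ)))) p.1) = mor0 f false /\
    tgt (morP (mor_comp h (box_at p.2 (glob (ksub dZ)))) p.1) = mor0 f true.
  by rewrite mor_src mor_tgt !h0.
have [|||F [cF F0 FA]] := @NDR_homotopy_extension R Z dZ
  (paths_between (mor0 f false) (mor0 f true))
  (fun z => kmk (fab z)) (fun p => kmk (hab p)) ndr.
- by apply: kmk_continuous; [exact: cg_k_space|exact: (@morP_continuous _ _ f)].
- apply: kmk_continuous; first exact: cg_k_space.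
  exact: (@box_at_continuous I (glob (ksub dZ)) Y h).
- move=> a; apply: kval_inj.
  by have /(congr1 (fun g => @morP (glob (ksub dZ)) Y g a)) := hf.
exists (glob_homotopy cF); split => [|t]; apply: flow_mor_ext => [[]|z] //.
- by rewrite glob_homotopyE F0.
- by apply: eq_trans (glob_homotopyE cF t (kval z)) _; rewrite FA.
Qed.
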